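(* For all non-negative integers $k,l$ and positive integers $n$, the set $\{D_\pi\mid \pi \text{ a } (k,l)\text{-bipartition with at most } n \text{ blocks}\}$ forms a basis of $\operatorname{Hom}_{S_n}(S^k(\mathbb{R}^n),S^l(\mathbb{R}^n))$. In particular, the linear map $\Theta_{k,n}^l:SP_k^l(n)\to\operatorname{Hom}_{S_n}(S^k(\mathbb{R}^n),S^l(\mathbb{R}^n))$ is surjective.
   Context: $[n]=\{1,\dots,n\}$. $S[n]^k$ is the set of weakly increasing $k$-tuples with entries in $[n]$ (for $k=0$, only the empty tuple). $S^k(\mathbb{R}^n)$ is the real vector space with standard basis $\{e_I\}$ indexed by $I\in S[n]^k$, with the $S_n$-representation $\rho_k^S(\sigma)e_I=e_{\operatorname{sort}(\sigma(I))}$, where $\sigma$ is applied entrywise and $\operatorname{sort}$ rearranges a tuple into weakly increasing order. $\operatorname{Hom}_{S_n}(S^k(\mathbb{R}^n),S^l(\mathbb{R}^n))$ is the vector space of linear maps $g$ with $g(\rho_k^S(\sigma)v)=\rho_l^S(\sigma)g(v)$ for all $\sigma\in S_n$, $v\in S^k(\mathbb{R}^n)$; linear maps are identified with their matrices in the standard bases. $E_{I,J}$ ($I\in S[n]^l$, $J\in S[n]^k$) is the matrix unit with $1$ in position $(I,J)$. A $(k,l)$-bipartition with $t$ blocks is a multiset $\{[x_1,y_1],\dots,[x_t,y_t]\}$ of $t$ pairs of non-negative integers, $x_i,y_i$ not both zero, with $\sum_i x_i=k$ and $\sum_i y_i=l$ (for $k=l=0$ the only one is empty); $b(\pi)$ denotes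 the number of blocks of $\pi$. The type of $(I,J)\in S[n]^l\times S[n]^k$ is the $(k,l)$-bipartition whose blocks are the pairs $[x_a,y_a]$, one for each $a\in[n]$ appearing in $I$ or $J$, with $x_a$ (resp. $y_a$) the number of occurrences of $a$ in $J$ (resp. $I$). For $b(\theta)\le n$, $X_\theta$ is the sum of all $E_{I,J}$ with $(I,J)$ of type $\theta$. Write $\pi\preceq\theta$ if the blocks of $\pi$ can be partitioned into non-empty groups whose componentwise sums are exactly the blocks of $\theta$. For any $(k,l)$-bipartition $\pi$, set $D_\pi=\sum_{\pi\preceq\theta,\ b(\theta)\le n}X_\theta$. $SP_k^l(n)$ is the real vector space with formal basis $\{x_\pi\}$ indexed by all $(k,l)$-bipartitions (no restriction on the number of blocks). The elements $d_\pi=\sum_{\pi\preceq\theta}x_\theta$ form another basis of it, and $\Theta_{k,n}^l$ is the linear map with $\Theta_{k,n}^l(d_\pi)=D_\pi$ for all $\pi$; equivalently, it is the linear map sending $x_\theta$ to $X_\theta$ if $b(\theta)\le n$ and to $0$ otherwise. *)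

(* Defs.v *)
From HB Require Import structures.
From mathcomp Require Import all_boot all_order all_fingroup all_algebra.
From mathcomp Require Import finmap multiset reals.

Set Implicit Arguments.
Unset Strict Implicit.
Unset Printing Implicit Defensive.

Import GRing.Theory.

Local Open Scope mset_scope.
Local Open Scope ring_scope.

(* [n] is represented by 'I_n = {0, ..., n-1}. *)

Definition leq_ord (n : nat) : rel 'I_n := fun i j => (i <= j)%N.

Record wtuple (n k : nat) := WTuple {
  wt_val :> k.-tuple 'I_n;
  wt_sorted : sorted (@leq_ord n) wt_val }.

HB.instance Definition _ (n k : nat) := [isSub for @wt_val n k].
HB.instance Definition _ (n k : nat) := [Finite of wtuple n k by <:].

Lemma leq_ord_total n : total (@leq_ord n).
Proof. by move=> i j; exact: leq_total. Qed.

Definition wt_act (n k : nat) (s : 'S_n) (I : wtuple n k) : wtuple n k :=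
  @WTuple n k (sort_tuple (@leq_ord n) (map_tuple s (wt_val I)))
    (sort_sorted (@leq_ord_total n) _).

Section SymmetricPower.
Variables (R : realType) (n : nat).

Definition SymPow (k : nat) : vectType R := {ffun wtuple n k -> R^o}.

Definition sp_e (k : nat) (I : wtuple n k) : SymPow k :=
  [ffun J => (J == I)%:R].

Definition rho_fun (k : nat) (s : 'S_n) (v : SymPow k) : SymPow k :=
  \sum_I v I *: sp_e (wt_act s I).

Fact rho_fun_linear k s : linear (@rho_fun k s).
Proof.
move=> a u v; rewrite /rho_fun scaler_sumr -big_split /=.
by apply: eq_bigr => I _; rewrite !ffunE scalerDl scalerA.
Qed.

HB.instance Definition _ k s :=
  GRing.isLinear.Build R (SymPow k) (SymPow k) _ (@rho_fun k s)
    (@rho_fun_linear k s).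

Definition rho (k : nat) (s : 'S_n) : 'End(SymPow k) := linfun (@rho_fun k s).

Lemma rho_e k s (I : wtuple n k) : rho k s (sp_e I) = sp_e (wt_act s I).
Proof.
rewrite lfunE /= /rho_fun (bigD1 I) //= ffunE eqxx scale1r big1 ?addr0 //.
by move=> J JI; rewrite ffunE (negPf JI) scale0r.
Qed.

Variables k l : nat.

Definition equiv_defect (s : 'S_n) (g : 'Hom(SymPow k, SymPow l)) :
    'Hom(SymPow k, SymPow l) :=
  ((g \o rho k s) - (rho l s \o g))%VF.

Fact equiv_defect_linear s : linear (equiv_defect s).
Proof.
move=> a f g; apply/lfunP => v; rewrite /equiv_defect.
rewrite !(comp_lfunE, add_lfunE, opp_lfunE, scale_lfunE) linearP.
by rewrite scalerBr opprD addrACA.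
Qed.

HB.instance Definition _ s :=
  GRing.isLinear.Build R 'Hom(SymPow k, SymPow l) 'Hom(SymPow k, SymPow l) _
    (equiv_defect s) (equiv_defect_linear s).

Definition HomSn : {vspace 'Hom(SymPow k, SymPow l)} :=
  (\bigcap_(s : 'S_n) lker (linfun (equiv_defect s)))%VS.

Lemma mem_HomSn (g : 'Hom(SymPow k, SymPow l)) :
  g \in HomSn <-> forall (s : 'S_n) (v : SymPow k), g (rho k s v) = rho l s (g v).
Proof.
rewrite memvE; split=> [/subv_bigcapP gP s v | gP].
  have := gP s isT; rewrite -memvE memv_ker lfunE /= /equiv_defect subr_eq0.
  by move=> /eqP/lfunP/(_ v); rewrite !comp_lfunE.
apply/subv_bigcapP => s _; rewrite -memvE memv_ker lfunE /= /equiv_defect.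
by rewrite subr_eq0; apply/eqP/lfunP => v; rewrite !comp_lfunE gP.
Qed.

End SymmetricPower.

(* nat * nat carries the componentwise nmodType structure, so that 0 is the
   pair (0, 0) and sums of blocks are componentwise. *)

Definition is_bipart (k l : nat) (m : {mset nat * nat}) : bool :=
  (0 \notin m) && (\sum_(b <- m) b == (k, l)).

Record bipart (k l : nat) := Bipart {
  bp_blocks :> {mset nat * nat};
  bp_prop : is_bipart k l bp_blocks }.

HB.instance Definition _ (k l : nat) := [isSub for @bp_blocks k l].
HB.instance Definition _ (k l : nat) := [Choice of bipart k l by <:].

Definition nblocks (k l : nat) (p : bipart k l) : nat := size p.

Section Bipart.
Variables k l : nat.

Lemma pair_sumE (I : Type) (r : seq I) (P : pred I) (F : I -> nat * nat) :
  \sum_(i <- r | P i) F i =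
  ((\sum_(i <- r | P i) (F i).1)%N, (\sum_(i <- r | P i) (F i).2)%N).
Proof. by elim/big_rec3: _ => //= i x1 x2 x _ ->. Qed.

Lemma bipart_sum (p : bipart k l) :
  (\sum_(b <- p) b.1 = k)%N /\ (\sum_(b <- p) b.2 = l)%N.
Proof. by case: p => m /= /andP[_]; rewrite pair_sumE => /eqP[-> ->]. Qed.

Lemma bipart_block_le (p : bipart k l) b :
  b \in (p : {mset _}) -> (b.1 <= k)%N /\ (b.2 <= l)%N.
Proof.
move=> bp; have [] := bipart_sum p.
rewrite !(big_rem b bp) /= => pk pl.
by split; [move: (leq_addr (\sum_(y <- rem b p) y.1) b.1)%N; rewrite pk
         | move: (leq_addr (\sum_(y <- rem b p) y.2) b.2)%N; rewrite pl].
Qed.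

Lemma nblocks_le (p : bipart k l) : (nblocks p <= k + l)%N.
Proof.
have [pk pl] := bipart_sum p.
suff: (nblocks p <= \sum_(b <- p) b.1 + \sum_(b <- p) b.2)%N by rewrite pk pl.
rewrite -big_split /= /nblocks -sum1_size !big_seq; apply: leq_sum => -[[|x] [|y]] // bp.
by case: (p) bp => m /= /andP[/negP].
Qed.

Let code (p : bipart k l) : (k + l).-bseq ('I_k.+1 * 'I_l.+1) :=
  insub_bseq (k + l) [seq (inord b.1, inord b.2) | b <- p].

Let decode (s : (k + l).-bseq ('I_k.+1 * 'I_l.+1)) : option (bipart k l) :=
  insub (seq_mset [seq (val b.1, val b.2) | b <- s]).

Fact bipart_codeK : pcancel code decode.
Proof.
move=> p; rewrite /decode /code /insub_bseq val_insubd size_map.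
rewrite (nblocks_le p) -map_comp map_id_in ?seq_mset_id ?valK // => -[x y] xyp.
by have [/= xk yl] := bipart_block_le xyp; rewrite !inordK.
Qed.

HB.instance Definition _ := PCanIsCountable bipart_codeK.
HB.instance Definition _ : isFinite (bipart k l) := PCanIsFinite bipart_codeK.

(* The groups are the parts of a partition of the set of positions of the
   blocks of p, so equal blocks are kept apart. *)
Definition coarsens (p t : bipart k l) : bool :=
  [exists P : {set {set 'I_(size p)}}, partition P [set: 'I_(size p)] &&
     perm_eq [seq \sum_(i in B) p`_i | B : {set 'I_(size p)} <- enum P] t].

Let singles (p : bipart k l) : {set {set 'I_(size p)}} :=
  set1 @: [set: 'I_(size p)].

Lemma perm_singles (p : bipart k l) :
  perm_eq [seq \sum_(i in B) p`_i | B : {set 'I_(size p)} <- enum (singles p)] p.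
Proof.
have: perm_eq (enum (singles p)) [seq [set i] | i <- enum 'I_(size p)].
  apply: uniq_perm; first exact: enum_uniq.
    by rewrite map_inj_uniq ?enum_uniq //; exact: set1_inj.
  move=> B; rewrite mem_enum; apply/imsetP/mapP => -[i _ ->];
  by exists i; rewrite // mem_enum.
move=> /(perm_map (fun B : {set 'I_(size p)} => \sum_(i in B) p`_i))/perm_trans; apply.
rewrite -map_comp (@eq_map _ _ _ (nth 0 p \o val)); last first.
  by move=> i; rewrite /= big_set1.
by rewrite map_comp val_enum_ord -/(mkseq _ _) mkseq_nth.
Qed.

Lemma coarsens_refl (p : bipart k l) : coarsens p p.
Proof.
apply/existsP; exists (singles p); rewrite perm_singles andbT.
apply/and3P; split.
- apply/eqP/setP => i; rewrite inE; apply/bigcupP.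
  by exists [set i]; rewrite ?inE //; apply: imset_f; rewrite inE.
- apply/trivIsetP => _ _ /imsetP[i _ ->] /imsetP[j _ ->] ij.
  by rewrite disjoints1 inE; apply: contraNN ij => /eqP->.
- by apply/imsetP => -[i _ /setP/(_ i)]; rewrite !inE eqxx.
Qed.

Lemma coarsens_lt (p t : bipart k l) :
  coarsens p t -> t != p -> (nblocks t < nblocks p)%N.
Proof.
case/existsP => P /andP[Ppart Pt] tp.
have szt : nblocks t = #|P| by rewrite /nblocks -(perm_size Pt) size_map -cardE.
have P1 B : B \in P -> (1 <= #|B| ?= iff (#|B| == 1))%N.
  move=> BP; rewrite eq_sym; apply: leqif_eq; rewrite card_gt0.
  by case/and3P: Ppart => _ _; apply: contraNneq => <-.
have [] := leqif_sum P1; rewrite -(card_partition Ppart) sum1_card cardsT card_ord.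
rewrite -szt ltn_neqAle => -> ->; rewrite andbT.
apply: contraNN tp => /forall_inP PE.
have sP : P = singles p.
  apply/eqP; rewrite eqEcard; apply/andP; split.
    apply/subsetP => B BP; have /cards1P[i ->] := PE _ BP.
    by apply: imset_f; rewrite inE.
  rewrite card_imset; last exact: set1_inj.
  rewrite (card_partition Ppart) (eq_bigr (fun=> 1%N)) ?sum1_card //.
  by move=> B /PE/eqP.
apply/eqP/val_inj; rewrite /= -[LHS]seq_mset_id -[RHS]seq_mset_id.
apply/eq_seq_msetP; rewrite perm_sym -(permPl (perm_singles p)) -sP.
exact: Pt.
Qed.

End Bipart.

Section PairType.
Variables (n k l : nat).

Definition pair_type_mset (I : wtuple n l) (J : wtuple n k) : {mset nat * nat} :=
  seq_mset [seq (count_mem a J, count_mem a I)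
           | a : 'I_n <- enum 'I_n & (a \in tval I) || (a \in tval J)].

Lemma sum_count_mem (m : nat) (I : m.-tuple 'I_n) (P : pred 'I_n) :
  (forall a, a \in I -> P a) -> (\sum_(a | P a) count_mem a I = m)%N.
Proof.
move=> IP; rewrite -[RHS]card_ord -sum1_card.
rewrite (partition_big (tnth I) P) /=; last by move=> i _; rewrite IP ?mem_tnth.
by apply: eq_bigr => a _; rewrite -sum1_count big_tuple.
Qed.

Fact pair_type_prop I J : is_bipart k l (pair_type_mset I J).
Proof.
apply/andP; split.
  rewrite (perm_mem (perm_eq_seq_mset _)); apply/mapP => -[a].
  rewrite mem_filter => /andP[+ _] [/esym/count_memPn aJ /esym/count_memPn aI].
  by rewrite (negPf aI) (negPf aJ).
rewrite (perm_big _ (perm_eq_seq_mset _)) /= big_map big_filter pair_sumE /=.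
rewrite !big_enum_cond /=.
by rewrite !sum_count_mem // => a ->; rewrite ?orbT.
Qed.

Definition pair_type (I : wtuple n l) (J : wtuple n k) : bipart k l :=
  Bipart (pair_type_prop I J).

End PairType.

Section Theta.
Variables (R : realType) (k l n : nat).

Definition munit_fun (I : wtuple n l) (J : wtuple n k) (v : SymPow R n k) :
  SymPow R n l := v J *: sp_e R I.

Fact munit_fun_linear I J : linear (munit_fun I J).
Proof. by move=> a u v; rewrite /munit_fun !ffunE scalerDl scalerA. Qed.

HB.instance Definition _ I J :=
  GRing.isLinear.Build R (SymPow R n k) (SymPow R n l) _ (munit_fun I J)
    (@munit_fun_linear I J).

(* The linear map whose matrix in the standard bases is E_{I,J}. *)
Definition munit (I : wtuple n l) (J : wtuple n k) :
  'Hom(SymPow R n k, SymPow R n l) := linfun (munit_fun I J).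

Lemma munit_e I J J' : munit I J (sp_e R J') = (J' == J)%:R *: sp_e R I.
Proof. by rewrite lfunE /= /munit_fun ffunE eq_sym. Qed.

Definition X_ (t : bipart k l) : 'Hom(SymPow R n k, SymPow R n l) :=
  \sum_(I : wtuple n l) \sum_(J : wtuple n k | pair_type I J == t) munit I J.

Definition D_ (p : bipart k l) : 'Hom(SymPow R n k, SymPow R n l) :=
  \sum_(t : bipart k l | coarsens p t && (nblocks t <= n)%N) X_ t.

Definition SP : vectType R := {ffun bipart k l -> R^o}.

Definition sp_x (t : bipart k l) : SP := [ffun u => (u == t)%:R].

Definition sp_d (p : bipart k l) : SP := \sum_(t | coarsens p t) sp_x t.

Lemma sp_x_decomp (v : SP) : v = \sum_t v t *: sp_x t.
Proof.
apply/ffunP => u; rewrite sum_ffunE (bigD1 u) //= !ffunE eqxx /=.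
rewrite big1 ?addr0 => [|t tu]; first by rewrite /GRing.scale /= mulr1.
by rewrite !ffunE eq_sym (negPf tu) scaler0.
Qed.

Lemma sp_d_basis :
  basis_of {:SP} [seq sp_d p | p : bipart k l].
Proof.
rewrite basisEdim size_map -cardE dimvf /= /dim /= muln1 leqnn andbT.
suff sub t : sp_x t \in <<[seq sp_d p | p : bipart k l]>>%VS.
  apply/subvP => v _; rewrite (sp_x_decomp v).
  by apply: memv_suml => t _; apply: memvZ.
have [m] := ubnP (nblocks t); elim: m t => // m IH t tm.
have -> : sp_x t = sp_d t - \sum_(u | coarsens t u && (u != t)) sp_x u.
  by rewrite /sp_d (bigD1 t) ?coarsens_refl //= addrK.
apply: memvB; first by apply: memv_span; apply: map_f; rewrite mem_enum.
apply: memv_suml => u /andP[tu ut]; apply: IH.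
exact: leq_trans (coarsens_lt tu ut) tm.
Qed.

Definition Theta_fun (v : SP) : 'Hom(SymPow R n k, SymPow R n l) :=
  \sum_(t : bipart k l | (nblocks t <= n)%N) v t *: X_ t.

Fact Theta_fun_linear : linear Theta_fun.
Proof.
move=> a u v; rewrite /Theta_fun scaler_sumr -big_split /=.
by apply: eq_bigr => I _; rewrite !ffunE scalerDl scalerA.
Qed.

HB.instance Definition _ :=
  GRing.isLinear.Build R SP 'Hom(SymPow R n k, SymPow R n l) _ Theta_fun
    Theta_fun_linear.

Definition Theta : 'Hom(SP, 'Hom(SymPow R n k, SymPow R n l)) :=
  linfun Theta_fun.

Lemma Theta_x t : Theta (sp_x t) = if (nblocks t <= n)%N then X_ t else 0.
Proof.
rewrite lfunE /= /Theta_fun big_mkcond (bigD1 t) //= ffunE eqxx scale1r.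
rewrite big1 ?addr0 // => u ut; rewrite ffunE (negPf ut) scale0r.
by case: ifP.
Qed.

Lemma Theta_d p : Theta (sp_d p) = D_ p.
Proof.
rewrite linear_sum /= /D_ big_mkcondr /=.
by apply: eq_bigr => t _; rewrite Theta_x.
Qed.

End Theta.

(* Main.v *)
(* A map g is equivariant iff its matrix is constant on the orbits of S_n on
   pairs (I, J). Since a sorted tuple is determined by its multiplicities, these
   orbits are exactly the fibres of the type, and the types that occur are the
   bipartitions with at most n blocks (pad the blocks with pairs (0, 0) to get
   multiplicities for all n letters). So the orbit sums X_t form a basis of
   Hom_{S_n}, and the D_p are unitriangular in the X_t, because strict
   coarsening decreases the number of blocks. *)

Require Import Defs.
From HB Require Import structures.
From mathcomp Require Import all_boot all_order all_fingroup all_algebra.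
From mathcomp Require Import finmap multiset reals.

Set Implicit Arguments.
Unset Strict Implicit.
Unset Printing Implicit Defensive.

Import GRing.Theory.

Local Open Scope mset_scope.
Local Open Scope ring_scope.

(** * Multiplicities of letters, types, and orbits of pairs of sorted tuples *)

Section Counting.
Variable n : nat.

Lemma wtuple_perm_inj k (I J : wtuple n k) : perm_eq I J -> I = J.
Proof.
move=> IJ; apply/val_inj/val_inj => /=.
have tr : transitive (@Defs.leq_ord n) by move=> b a c; exact: leq_trans.
have asym : antisymmetric (@Defs.leq_ord n).
  by move=> a b ab; apply/val_inj/anti_leq.
exact: sorted_eq tr asym _ _ (wt_sorted I) (wt_sorted J) IJ.
Qed.

Lemma perm_wt_act k (s : 'S_n) (I : wtuple n k) :
  perm_eq (wt_act s I) [seq s a | a <- I].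
Proof. by rewrite /= perm_sort. Qed.

Lemma wt_act_inj k (s : 'S_n) : injective (@wt_act n k s).
Proof.
move=> I J IJ; apply/wtuple_perm_inj/(perm_map_inj (@perm_inj _ s)).
by rewrite -(permPl (perm_wt_act s I)) IJ perm_wt_act.
Qed.

Lemma count_wt_act k (s : 'S_n) (I : wtuple n k) a :
  count_mem (s a) (wt_act s I) = count_mem a I.
Proof.
rewrite (seq.permP (perm_wt_act s I)) count_map; apply: eq_count => b /=.
by rewrite (inj_eq (@perm_inj _ s)).
Qed.

Lemma wtuple_count_inj k (I J : wtuple n k) :
  (forall a, count_mem a I = count_mem a J) -> I = J.
Proof.
move=> IJ; apply/wtuple_perm_inj/allP => a _; apply/eqP; exact: IJ.
Qed.

Lemma wtuple_of_counts k (f : 'I_n -> nat) :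
  (\sum_a f a = k)%N -> exists I : wtuple n k, forall a, count_mem a I = f a.
Proof.
move=> fk; pose s := flatten [seq nseq (f a) a | a <- enum 'I_n].
have sk : size (sort (@Defs.leq_ord n) s) == k.
  rewrite size_sort size_flatten /shape -map_comp sumnE big_map big_enum /=.
  by rewrite -fk; apply/eqP/eq_bigr => a _; rewrite size_nseq.
have ss : sorted (@Defs.leq_ord n) (Tuple sk) by apply/sort_sorted/leq_ord_total.
exists (WTuple ss) => a /=.
rewrite count_sort count_flatten -map_comp sumnE big_map big_enum /=.
rewrite (bigD1 a) //= count_nseq /= eqxx mul1n big1 ?addn0 // => b ba.
by rewrite count_nseq /= (negPf ba).
Qed.

Definition count_pairs k l (I : wtuple n l) (J : wtuple n k) (a : 'I_n) :
  nat * nat := (count_mem a J, count_mem a I).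

(** A letter is missing from both tuples exactly when its count pair is [0]. Ranging over all [n]
    letters makes the type easy to reindex by a permutation. *)
Lemma perm_pair_type k l (I : wtuple n l) (J : wtuple n k) :
  perm_eq (pair_type I J : {mset nat * nat})
          [seq x <- [seq count_pairs I J a | a <- enum 'I_n] | x != 0].
Proof.
have E : preim (count_pairs I J) (fun x => x != 0) =1
    (fun a => (a \in tval I) || (a \in tval J)).
  move=> a; rewrite /= /count_pairs -[0]/(0%N, 0%N) xpair_eqE.
  by rewrite negb_and orbC -!lt0n -!has_count !has_pred1.
rewrite filter_map (eq_filter E); exact: perm_eq_seq_mset.
Qed.

Lemma nblocks_pair_type k l (I : wtuple n l) (J : wtuple n k) :
  (nblocks (pair_type I J) <= n)%N.
Proof.
rewrite /nblocks (perm_size (perm_pair_type I J)) size_filter.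
by rewrite (leq_trans (count_size _ _)) // size_map size_enum_ord.
Qed.

Lemma bipart_perm_inj k l (p q : bipart k l) :
  perm_eq (p : {mset nat * nat}) (q : {mset nat * nat}) -> p = q.
Proof.
move=> pq; apply/val_inj; rewrite /= -[LHS]seq_mset_id -[RHS]seq_mset_id.
exact/eq_seq_msetP.
Qed.

Lemma pair_type_act k l (s : 'S_n) (I : wtuple n l) (J : wtuple n k) :
  pair_type (wt_act s I) (wt_act s J) = pair_type I J.
Proof.
apply: bipart_perm_inj; rewrite (permPl (perm_pair_type _ _)) perm_sym.
rewrite (permPl (perm_pair_type _ _)); apply: perm_filter.
(* The count pair of [a] becomes that of [s a], so the list of count pairs is only reordered. *)
have cE : count_pairs I J =1 count_pairs (wt_act s I) (wt_act s J) \o s.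
  by move=> a; rewrite /count_pairs /= !count_wt_act.
have senum : perm_eq [seq s a | a <- enum 'I_n] (enum 'I_n).
  apply: uniq_perm; last 1 first.
  - move=> a; rewrite mem_enum; apply/mapP; exists (s^-1%g a); rewrite ?mem_enum //.
    by rewrite permKV.
  - by rewrite map_inj_uniq ?enum_uniq //; exact: perm_inj.
  - exact: enum_uniq.
rewrite (eq_map cE) map_comp; exact: perm_map senum.
Qed.

(** Equal lengths force equally many discarded copies of [x]. With [x = 0] this restores the zero
    count pairs that a type forgets. *)
Lemma perm_filter_neq (T : eqType) (x : T) (s1 s2 : seq T) :
  size s1 = size s2 ->
  perm_eq [seq y <- s1 | y != x] [seq y <- s2 | y != x] -> perm_eq s1 s2.
Proof.
move=> ss p12.
have nseqE (s : seq T) : [seq y <- s | ~~ (y != x)] = nseq (count_mem x s) x.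
  rewrite (@eq_filter _ _ (pred1 x)) => [|y]; last by rewrite /= negbK.
  by rewrite -size_filter; apply/all_pred1P/filter_all.
rewrite -(permPl (permEl (perm_filterC (fun y => y != x) s1))).
rewrite -(permPr (permEl (perm_filterC (fun y => y != x) s2))).
apply: perm_cat => //; rewrite !nseqE.
have /eqP := perm_size p12; rewrite !size_filter.
have /eqP := ss; rewrite -(count_predC (pred1 x) s1) -(count_predC (pred1 x) s2).
by move=> /[swap] /eqP->; rewrite eqn_add2r => /eqP->.
Qed.

Lemma pair_type_eq_act k l (I I' : wtuple n l) (J J' : wtuple n k) :
  pair_type I J = pair_type I' J' ->
  exists s : 'S_n, I' = wt_act s I /\ J' = wt_act s J.
Proof.
move=> tE.
have : perm_eq [seq count_pairs I J a | a <- enum 'I_n]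
               [seq count_pairs I' J' a | a <- enum 'I_n].
  apply: (@perm_filter_neq _ 0); first by rewrite !size_map.
  by rewrite -(permPl (perm_pair_type _ _)) tE perm_pair_type.
pose c' := [tuple count_pairs I' J' a | a < n].
(* Positions in the two lists are the letters themselves, so the permutation matching the lists is
   the required [s]. *)
move=> /(@tuple_permP _ _ _ c')[s sE].
have cE a : count_pairs I J a = count_pairs I' J' (s a).
  have /(congr1 (fun r => nth 0 r a)) := sE.
  rewrite (nth_map a) ?size_enum_ord // nth_ord_enum => ->.
  by rewrite -tnth_nth !tnth_mktuple.
exists s; split; apply: wtuple_count_inj => a; rewrite -(permKV s a) count_wt_act;
  by have [] := cE (s^-1%g a).
Qed.

Lemma pair_type_surj k l (t : bipart k l) : (nblocks t <= n)%N ->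
  exists (I : wtuple n l) (J : wtuple n k), pair_type I J = t.
Proof.
(* Letter [a] receives the [a]-th block; letters past the last block receive the default [0] of
   [nth]. *)
move=> tn; pose c (a : 'I_n) : nat * nat := (t : {mset _})`_a.
have cE : [seq c a | a <- enum 'I_n] = (t : {mset _}) ++ nseq (n - nblocks t) 0.
  apply: (@eq_from_nth _ 0).
    by rewrite size_map size_enum_ord size_cat size_nseq subnKC.
  move=> i; rewrite size_map size_enum_ord => lt_in.
  rewrite (nth_map (Ordinal lt_in)) ?size_enum_ord // /c nth_enum_ord //.
  rewrite nth_cat nth_nseq if_same; case: ltnP => // ti.
  by rewrite nth_default.
have [tk tl] := bipart_sum t.
have sumE (f : nat * nat -> nat) : f 0 = 0%N ->
    (\sum_a f (c a) = \sum_(b <- t) f b)%N.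
  move=> f0; rewrite -big_enum /= -(big_map c xpredT f) cE big_cat.
  rewrite /= [X in (_ + X)%N]big1_seq ?addn0 // => x /andP[_].
  by rewrite mem_nseq => /andP[_ /eqP->].
have [J JE] : exists J : wtuple n k, forall a, count_mem a J = (c a).1.
  by apply: wtuple_of_counts; rewrite (sumE fst).
have [I IE] : exists I : wtuple n l, forall a, count_mem a I = (c a).2.
  by apply: wtuple_of_counts; rewrite (sumE snd).
exists I, J; apply: bipart_perm_inj; rewrite (permPl (perm_pair_type _ _)).
have /eq_map-> : count_pairs I J =1 c.
  by move=> a; rewrite /count_pairs JE IE -surjective_pairing.
(* Blocks are nonzero, so the filter removes precisely the padding. *)
rewrite cE filter_cat (@eq_in_filter _ _ xpredT) => [|x xt]; last first.
  apply: contraTneq xt => ->; by have /andP[] := bp_prop t.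
rewrite filter_predT (@eq_in_filter _ _ pred0) => [|x]; last first.
  by rewrite mem_nseq => /andP[_ /eqP->]; rewrite eqxx.
by rewrite filter_pred0 cats0.
Qed.

End Counting.

(** * Matrix entries of equivariant maps, orbit sums, and passage to the [D_ p] *)

Section Coefficients.
Variables (R : realType) (k l n : nat).

Local Notation Hom := 'Hom(SymPow R n k, SymPow R n l).

Lemma sp_e_decomp m (v : SymPow R n m) : v = \sum_J v J *: sp_e R J.
Proof.
apply/ffunP => I; rewrite sum_ffunE (bigD1 I) //= !ffunE eqxx big1 => [|J JI].
  by rewrite addr0 /GRing.scale /= mulr1.
by rewrite !ffunE eq_sym (negPf JI) scaler0.
Qed.

Lemma lfun_coefP (f g : Hom) :
  (forall I J, f (sp_e R J) I = g (sp_e R J) I) -> f = g.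
Proof.
move=> fg; apply/lfunP => v; rewrite (sp_e_decomp v) !linear_sum /=.
apply: eq_bigr => J _; rewrite !linearZ /=; congr (_ *: _).
exact/ffunP.
Qed.

Lemma rho_act m (s : 'S_n) (v : SymPow R n m) I :
  rho R m s v (wt_act s I) = v I.
Proof.
rewrite lfunE /= /rho_fun sum_ffunE (bigD1 I) //= !ffunE eqxx big1 => [|J JI].
  by rewrite addr0 /GRing.scale /= mulr1.
by rewrite !ffunE (inj_eq (@wt_act_inj _ _ s)) eq_sym (negPf JI) scaler0.
Qed.

Lemma HomSn_coefP (g : Hom) :
  g \in HomSn R n k l <->
  forall (s : 'S_n) I J, g (sp_e R (wt_act s J)) (wt_act s I) = g (sp_e R J) I.
Proof.
rewrite mem_HomSn; split=> gP s; first by move=> I J; rewrite -rho_e gP rho_act.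
suff /lfunP gs : (g \o rho R k s = rho R l s \o g)%VF.
  by move=> v; rewrite -!comp_lfunE gs.
apply: lfun_coefP => I J; rewrite !comp_lfunE rho_e.
(* An injective self-map of a finite type is bijective, so every index [I] has the form
   [wt_act s (f I)]. *)
have [f _ fK] := injF_bij (@wt_act_inj n l s).
by rewrite -(fK I) rho_act gP.
Qed.

Lemma X_coef (t : bipart k l) I J :
  X_ R n t (sp_e R J) I = (pair_type I J == t)%:R.
Proof.
rewrite /X_ sum_lfunE sum_ffunE (bigD1 I) //= [X in _ + X]big1 => [|I' I'I].
  rewrite addr0 big_mkcond /= sum_lfunE sum_ffunE (bigD1 J) //= big1 => [|J' J'J].
    rewrite addr0; case: ifP => _; last by rewrite zero_lfunE ffunE.
    by rewrite munit_e eqxx scale1r ffunE eqxx.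
  case: ifP => _; last by rewrite zero_lfunE ffunE.
  by rewrite munit_e eq_sym (negPf J'J) scale0r ffunE.
rewrite sum_lfunE sum_ffunE big1 // => J' _.
by rewrite munit_e !ffunE (eq_sym I) (negPf I'I) scaler0.
Qed.

Lemma X_HomSn (t : bipart k l) : X_ R n t \in HomSn R n k l.
Proof. by apply/HomSn_coefP => s I J; rewrite !X_coef pair_type_act. Qed.

Definition small_biparts := [seq p <- enum {: bipart k l} | (nblocks p <= n)%N].

Lemma mem_small_biparts p : (p \in small_biparts) = (nblocks p <= n)%N.
Proof. by rewrite mem_filter mem_enum andbT. Qed.

Lemma HomSn_sub_span_X :
  (HomSn R n k l <= <<[seq X_ R n t | t <- small_biparts]>>)%VS.
Proof.
apply/subvP => g /HomSn_coefP gP.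
(* The coefficient of [X_ t] is the entry of [g] at an arbitrarily picked pair of type [t]; the
   choice is harmless because pairs of equal type lie in one orbit. *)
pose c t := if [pick IJ : wtuple n l * wtuple n k | pair_type IJ.1 IJ.2 == t]
  is Some IJ then g (sp_e R IJ.2) IJ.1 else 0.
have -> : g = \sum_(t : bipart k l | (nblocks t <= n)%N) c t *: X_ R n t.
  apply: lfun_coefP => I J; rewrite sum_lfunE sum_ffunE.
  rewrite (bigD1 (pair_type I J)) ?nblocks_pair_type //= big1 => [|t /andP[_ tIJ]].
    rewrite addr0 scale_lfunE ffunE X_coef eqxx /c.
    case: pickP => [[I' J'] /= /eqP tE|/(_ (I, J))]; last by rewrite eqxx.
    have [s [-> ->]] := pair_type_eq_act tE.
    by rewrite gP /GRing.scale /= mulr1.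
  by rewrite scale_lfunE ffunE X_coef eq_sym (negPf tIJ) scaler0.
apply: memv_suml => t tn; apply/memvZ/memv_span/map_f.
by rewrite mem_small_biparts.
Qed.

(** The orbit sums have disjoint supports; this is the form used by the induction in [free_X]. *)
Lemma span_X_coef (s : seq (bipart k l)) (g : Hom) I J :
  g \in <<[seq X_ R n t | t <- s]>>%VS -> pair_type I J \notin s ->
  g (sp_e R J) I = 0.
Proof.
elim: s g => [|t s IH] g /=;
  first by rewrite span_nil memv0 => /eqP->; rewrite zero_lfunE ffunE.
rewrite span_cons inE negb_or => /memv_addP[_ /vlineP[a ->] [h hs ->]] /andP[IJt IJs].
by rewrite add_lfunE scale_lfunE !ffunE X_coef (negPf IJt) scaler0 add0r IH.
Qed.

Lemma free_X (s : seq (bipart k l)) :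
  uniq s -> all (fun t => nblocks t <= n)%N s -> free [seq X_ R n t | t <- s].
Proof.
elim: s => [|t s IH] /=; first by rewrite nil_free.
move=> /andP[ts us] /andP[tn sn]; rewrite free_cons IH // andbT.
(* The block bound yields a pair of type [t], where [X_ t] has entry 1 and the span of the remaining
   orbit sums has entry 0. *)
have [I [J tE]] := pair_type_surj tn.
apply/negP => /(@span_X_coef _ _ I J); rewrite tE => /(_ ts)/eqP.
by rewrite X_coef tE eqxx oner_eq0.
Qed.

(** Inverts the unitriangular system by strong induction on the number of blocks: [D_ t] minus
    [X_ t] involves only strict coarsenings of [t]. *)
Lemma X_span_D (t : bipart k l) : (nblocks t <= n)%N ->
  X_ R n t \in <<[seq D_ R n p | p <- small_biparts]>>%VS.
Proof.
have [m] := ubnP (nblocks t); elim: m t => // m IH t tm tn.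
have -> : X_ R n t = D_ R n t -
    \sum_(u | coarsens t u && (nblocks u <= n)%N && (u != t)) X_ R n u.
  by rewrite /D_ (bigD1 t) ?coarsens_refl //= addrK.
apply: memvB; first by apply/memv_span/map_f; rewrite mem_small_biparts.
apply: memv_suml => u /andP[/andP[tu un] ut]; apply: IH un.
exact: leq_trans (coarsens_lt tu ut) tm.
Qed.

Lemma HomSn_sub_span_D :
  (HomSn R n k l <= <<[seq D_ R n p | p <- small_biparts]>>)%VS.
Proof.
apply: subv_trans HomSn_sub_span_X _; apply/span_subvP => _ /mapP[t + ->].
by rewrite mem_small_biparts; exact: X_span_D.
Qed.

(** Freeness of the orbit sums is used only for this dimension bound. *)
Lemma size_small_biparts_le_dim : (size small_biparts <= \dim (HomSn R n k l))%N.
Proof.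
have /eqP <- : \dim <<[seq X_ R n t | t <- small_biparts]>> == size small_biparts.
  rewrite -(size_map (X_ R n)); apply: free_X; first exact/filter_uniq/enum_uniq.
  exact: filter_all.
by apply/dimvS/span_subvP => _ /mapP[t _ ->]; exact: X_HomSn.
Qed.

End Coefficients.

Theorem theorem5p7 (R : realType) (k l n : nat) (n_gt0 : (0 < n)%N) :
  basis_of (HomSn R n k l)
    [seq D_ R n p | p <- enum {: bipart k l} & (nblocks p <= n)%N]
  /\ limg (Theta R k l n) = HomSn R n k l.
Proof.
(* A family whose span contains the space and whose size is at most its dimension is a basis, so
   freeness of the [D_ p] comes from counting. *)
split; first by rewrite basisEdim HomSn_sub_span_D size_map size_small_biparts_le_dim.
apply/eqP; rewrite eqEsubv; apply/andP; split.
  apply/subvP => _ /memv_imgP[v _ ->]; rewrite lfunE.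
  by apply: memv_suml => t _; apply/memvZ/X_HomSn.
(* Surjectivity: each spanning element [D_ p] is the image of [sp_d p]. *)
apply: subv_trans (@HomSn_sub_span_D R k l n) _.
apply/span_subvP => _ /mapP[p _ ->].
by rewrite -Theta_d memv_img ?memvf.
Qed.
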